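(* Let $\mathbb{K}$ be a field, let $n, t \in \mathbb{N}$ and let $\lambda = (\lambda_1,\ldots,\lambda_n) \in \mathbb{N}_0^n$. For each $i \in \{1,\ldots,n\}$ let $S_i$ be a finite $\lambda_i$-null subset of $\mathbb{K}$, and let $S := S_1 \times \cdots \times S_n$. Let $f \in \mathbb{K}[x_1,\ldots,x_n]$ and let $\alpha = (\alpha_1, \ldots, \alpha_n) \in \mathbb{N}_0^n$ be such that \[ \text{for all } \beta \in \mathbb{N}_0^n \text{ with } \textstyle\sum_{i=1}^n \beta_i = t \text{ there is } i \in \{1,\ldots,n\} \text{ with } \alpha_i < \beta_i |S_i|, \] and $f$ contains the monomial $x_1^{\alpha_1} \cdots x_n^{\alpha_n}$. Assume further that for every monomial $x^{\gamma}$ appearing in $f$ with $\gamma \neq \alpha$ there is $i \in \{1,\ldots,n\}$ with $\gamma_i \neq \alpha_i$ such that either $\gamma_i \in [0, \alpha_i - 1] \cup [\alpha_i + 1, \alpha_i + \lambda_i]$, or for all $\beta \in \mathbb{N}_0^n$ with $\sum_{j=1}^n \beta_j = t$ and $\beta_i > 0$ there exists $j \in \{1,\ldots,n\}$ with $\gamma_j < \beta_j |S_j|$. Then there is $\mathbf{s} \in S$ such that $\mathbf{s}$ is not a $t$-fold zero of $f$.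
   Context: For integers $a,b$, $[a,b] := \{x \in \mathbb{N}_0 \mid a \le x \le b\}$ (empty if $a > b$). For $\lambda \in \mathbb{N}_0$, a univariate polynomial $p \in \mathbb{K}[x]$ of degree $\nu$ is $\lambda$-lacunary if all coefficients of $x^k$ with $\nu - \lambda \le k < \nu$ vanish; a finite $A \subseteq \mathbb{K}$ is $\lambda$-null if $\prod_{a \in A}(x-a)$ is $\lambda$-lacunary. For $t \in \mathbb{N}_0$ and $\mathbf{c} = (c_1,\ldots,c_n) \in \mathbb{K}^n$, $\mathbf{c}$ is a $t$-fold zero of $f$ if $f(c_1 + x_1, \ldots, c_n + x_n)$ lies in the ideal $\langle x_1, \ldots, x_n\rangle^t$ (equivalently, contains no monomial of total degree less than $t$). A polynomial ''contains'' a monomial if it appears with nonzero coefficient. *)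

(* Defs.v *)
From HB Require Import structures.
From mathcomp Require Export all_boot all_algebra.
From mathcomp Require Export finmap mpoly.

Set Implicit Arguments.
Unset Strict Implicit.
Unset Printing Implicit Defensive.

Import GRing.Theory.
Local Open Scope ring_scope.

(* With [size p = nu + 1], the truncated subtraction [nu - lam] is harmless:
   it only replaces a negative lower bound on [k : nat] by 0. *)
Definition lacunary (K : fieldType) (lam : nat) (p : {poly K}) : Prop :=
  forall k : nat, ((size p).-1 - lam <= k < (size p).-1)%N -> p`_k = 0.

Definition null_set (K : fieldType) (lam : nat) (A : {fset K}) : Prop :=
  lacunary lam (\prod_(a <- A) ('X - a%:P)).

Definition gen_ideal (R : comNzRingType) (G : R -> Prop) (p : R) : Prop :=
  exists s : seq (R * R),
    (forall ag : R * R, ag \in s -> G ag.2) /\ p = \sum_(ag <- s) ag.1 * ag.2.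

(* For [t = 0] the only product is the empty one, 1, so this is the whole
   ring. *)
Definition ideal_exp (R : comNzRingType) (I : R -> Prop) (t : nat) :
    R -> Prop :=
  gen_ideal (fun p : R =>
    exists h : 'I_t -> R, (forall i, I (h i)) /\ p = \prod_(i < t) h i).

Definition var_ideal (K : fieldType) (n : nat) : {mpoly K[n]} -> Prop :=
  gen_ideal (fun p : {mpoly K[n]} => exists i : 'I_n, p = 'X_i).

Definition shift_mpoly (K : fieldType) (n : nat) (c : 'I_n -> K)
    (f : {mpoly K[n]}) : {mpoly K[n]} :=
  f \mPo [tuple (c i)%:MP + 'X_i | i < n].

Definition fold_zero (K : fieldType) (n t : nat) (f : {mpoly K[n]})
    (c : 'I_n -> K) : Prop :=
  ideal_exp (@var_ideal K n) t (shift_mpoly c f).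

(* Main.v *)
(* Let d i = #|S i|. Since the g_i = prod_(a in S i) (X - a) have a gap of length
   lam i below their leading term, subtracting multiples of the products
   x^(gamma - d b) prod_i g_i^(b i) with |b| = t, which vanish to order t on S,
   replaces f by some r whose monomials m all satisfy sum_i (m i %/ d i) < t,
   without changing the coefficient at alpha: the hypotheses on the monomials
   of f say exactly that none of them can be rewritten into alpha. So r is
   nonzero, and expanding it in the Newton basis of the periodic node sequence
   S i, S i, ... shows that it cannot vanish to order t on all of S. *)
Require Import Defs.
From mathcomp Require Import all_boot all_algebra.
From mathcomp Require Import finmap mpoly.

Set Implicit Arguments.
Unset Strict Implicit.
Unset Printing Implicit Defensive.

Import GRing.Theory.
Local Open Scope ring_scope.

(** * Univariate monic polynomials with a gap below the leading term *)

(** For [lam = 0] this is just monic of degree [nu]. Passing [nu] explicitly lets degrees simply add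
    up under products. *)
Definition gap_monic (R : nzRingType) (lam nu : nat) (p : {poly R}) : Prop :=
  p`_nu = 1 /\ forall k, p`_k != 0 -> k = nu \/ (k + lam < nu)%N.

Lemma gap_monicXn (R : nzRingType) lam nu : gap_monic lam nu ('X^nu : {poly R}).
Proof.
split=> [|k]; first by rewrite coefXn eqxx.
by rewrite coefXn; have [->|_] := eqVneq k nu; [left | rewrite eqxx].
Qed.

(** A nonzero coefficient at [k] needs [k = a + b] with [a], [b] in the two supports. Unless both
    are the top exponents, one of them falls short by more than [lam], hence so does the sum. *)
Lemma gap_monicM (R : nzRingType) lam mu nu (p q : {poly R}) :
  gap_monic lam mu p -> gap_monic lam nu q -> gap_monic lam (mu + nu) (p * q).
Proof.
move=> [p1 pgap] [q1 qgap]; split=> [|k].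
  have lt_mu : (mu < (mu + nu).+1)%N by rewrite ltnS leq_addr.
  rewrite coefM (bigD1 (Ordinal lt_mu)) //= addKn p1 q1 mul1r.
  rewrite big1 ?addr0 // => -[j ltj] /= neq_j.
  have [->|/pgap [ej|lt_j]] := eqVneq p`_j 0; first by rewrite mul0r.
    by rewrite -val_eqE /= ej eqxx in neq_j.
  have [->|/qgap] := eqVneq q`_(mu + nu - j) 0; first by rewrite mulr0.
  have lt_nu : (nu < mu + nu - j)%N.
    by rewrite ltn_subRL ltn_add2r (leq_ltn_trans _ lt_j) // leq_addr.
  case=> [e|lt']; first by rewrite e ltnn in lt_nu.
  by have:= leq_ltn_trans (leq_addr lam _) lt'; rewrite ltnNge ltnW.
rewrite coefM => nz_sum.
have [j /andP [nzp nzq]] : exists j : 'I_k.+1, (p`_j != 0) && (q`_(k - j) != 0).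
  apply/existsP; apply: contraNT nz_sum => /existsPn z.
  rewrite big1 // => j _; move: (z j); rewrite negb_and !negbK.
  by case/orP => /eqP ->; rewrite ?mul0r ?mulr0.
have ek : k = (j + (k - j))%N by rewrite subnKC // -ltnS ltn_ord.
move: nzp nzq ek; move: (k - j)%N (j : nat) => b a /pgap pa /qgap qb ->.
case: pa qb => [->|lta] [->|ltb]; first by left.
- by right; rewrite -addnA ltn_add2l.
- by right; rewrite addnAC ltn_add2r.
right; rewrite -addnA -addnS leq_add //.
by rewrite ltnW // (leq_ltn_trans (leq_addr lam a)).
Qed.

Lemma gap_monic1 (R : nzRingType) lam : gap_monic lam 0 (1 : {poly R}).
Proof. exact: (gap_monicXn R lam 0). Qed.

Lemma gap_monic_exp (R : nzRingType) lam nu (p : {poly R}) e :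
  gap_monic lam nu p -> gap_monic lam (nu * e) (p ^+ e).
Proof.
move=> gp; elim: e => [|e IH]; first by rewrite muln0 expr0; apply: gap_monic1.
by rewrite mulnS exprS; apply: gap_monicM.
Qed.

Lemma gap_monic_prod_XsubC (R : nzRingType) (s : seq R) :
  gap_monic 0 (size s) (\prod_(a <- s) ('X - a%:P)).
Proof.
elim: s => [|a s IH]; first by rewrite big_nil; apply: gap_monic1.
rewrite big_cons -[size _]/(1 + size s)%N; apply: gap_monicM => //.
split=> [|[|[|k]]]; first by rewrite coefB coefX coefC subr0.
- by right.
- by left.
by rewrite coefB coefX coefC subr0 eqxx.
Qed.

Lemma null_set_gap (K : fieldType) lam (A : {fset K}) :
  null_set lam A -> gap_monic lam #|` A| (\prod_(a <- A) ('X - a%:P)).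
Proof.
rewrite /null_set /lacunary size_prod_XsubC /= => lac.
have [g1 ggap] := gap_monic_prod_XsubC A; split=> // k nz_k.
have [|lt_k] := ggap k nz_k; [by left | right].
rewrite addn0 in lt_k; rewrite ltnNge; apply: contra nz_k => le_k.
by rewrite lac ?eqxx // leq_subLR addnC le_k.
Qed.

(** * Newton basis of a periodic node sequence, expanded at its nodes *)

Lemma coef_shift_root_exp (K : fieldType) (a : K) c k (q : {poly K}) :
  (((('X - a%:P) ^+ c * q) \Po ('X + a%:P))`_k) =
  if (k < c)%N then 0 else (q \Po ('X + a%:P))`_(k - c).
Proof.
rewrite comp_polyM rmorphXn /=.
by rewrite comp_polyB comp_polyX comp_polyC addrK coefXnM.
Qed.

(** Newton basis polynomial on the first [k] terms of the sequence [s], [s], ...: [k %/ size s] full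
    turns, then a partial turn of [k %% size s] nodes. *)
Definition newton (K : fieldType) (s : seq K) (k : nat) : {poly K} :=
  (\prod_(a <- s) ('X - a%:P)) ^+ (k %/ size s) *
  \prod_(a <- take (k %% size s) s) ('X - a%:P).

Lemma gap_monic_newton (K : fieldType) (s : seq K) k :
  (0 < size s)%N -> gap_monic 0 k (newton s k).
Proof.
move=> s_gt0; rewrite {1}(divn_eq k (size s)) mulnC.
apply: gap_monicM; first exact/gap_monic_exp/gap_monic_prod_XsubC.
have := gap_monic_prod_XsubC (take (k %% size s) s).
by rewrite size_take ltn_mod s_gt0.
Qed.

(** The shift is to the node following the first [k] ones. It occurs exactly once in each full turn,
    and the partial turn stops just before it, so its multiplicity is exactly [k %/ size s]. *)
Lemma newton_shift_neq0 (K : fieldType) (s : seq K) k :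
  uniq s -> (0 < size s)%N ->
  (newton s k \Po ('X + (s`_(k %% size s))%:P))`_(k %/ size s) != 0.
Proof.
move=> uniq_s s_gt0; have lt_mod : (k %% size s < size s)%N by rewrite ltn_mod.
set a := s`__; have a_s : a \in s by rewrite mem_nth.
rewrite /newton (big_rem a) //= exprMn -mulrA coef_shift_root_exp ltnn subnn.
(* The constant coefficient left over is the value at [a] of the product of the remaining
   factors. *)
rewrite -horner_coef0 horner_comp !hornerE.
have root_free (r : seq K) : a \notin r -> (\prod_(b <- r) ('X - b%:P)).[a] != 0.
  move=> a_r; rewrite horner_prod prodf_seq_neq0; apply/allP => b b_r /=.
  by rewrite !hornerE subr_eq0; apply: contra a_r => /eqP ->.
rewrite mulf_neq0 ?expf_neq0 ?root_free //; first by rewrite mem_rem_uniqF.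
by rewrite in_take_leq ?(ltnW lt_mod) // index_uniq // ltnn.
Qed.

(** The first [l > k] nodes include the one at position [k], so its multiplicity exceeds
    [k %/ size s]. *)
Lemma newton_shift_eq0 (K : fieldType) (s : seq K) k l :
  (0 < size s)%N -> (k < l)%N ->
  (newton s l \Po ('X + (s`_(k %% size s))%:P))`_(k %/ size s) = 0.
Proof.
move=> s_gt0 lt_kl; have lt_mod : (k %% size s < size s)%N by rewrite ltn_mod.
set a := s`__; have a_s : a \in s by rewrite mem_nth.
have [q ->] : exists q, newton s l = ('X - a%:P) ^+ (k %/ size s).+1 * q.
  rewrite /newton (big_rem a) //= exprMn.
  have := leq_div2r (size s) (ltnW lt_kl).
  rewrite leq_eqVlt => /orP [/eqP e|lt_div]; last first.
    rewrite -(subnKC lt_div) exprD.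
    by eexists; rewrite -!mulrA; reflexivity.
  (* The quotients now agree, so [k %% size s < l %% size s] and the partial turn supplies the extra
     factor. *)
  have a_t : a \in take (l %% size s) s.
    rewrite /a -(@nth_take (l %% size s)).
      apply: mem_nth; rewrite size_take ltn_mod s_gt0.
      by rewrite -(ltn_add2l (l %/ size s * size s)) -divn_eq -e -divn_eq.
    by rewrite -(ltn_add2l (l %/ size s * size s)) -divn_eq -e -divn_eq.
  rewrite (big_rem a a_t) /= -e exprS.
  set B := (X in _ * X * _); set C := \prod_(y <- rem a (take _ _)) _.
  by exists (B * C); rewrite mulrACA [_ * ('X - _)]mulrC.
by rewrite coef_shift_root_exp ltnS leqnn.
Qed.

(** * Products of univariate polynomials in separate variables, and triangular families *)

Definition split_mpoly (K : fieldType) n (p : 'I_n -> {poly K}) : {mpoly K[n]} :=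
  \prod_(i < n) horner_alg ('X_i : {mpoly K[n]}) (p i).

Lemma horner_algE (K : fieldType) (A : algType K) (a : A) N (p : {poly K}) :
  (size p <= N)%N -> horner_alg a p = \sum_(k < N) p`_k *: a ^+ k.
Proof.
move=> le_pN; rewrite -{1}[p](coefK p) (poly_def) (big_ord_widen N (fun k => p`_k *: 'X^k)) //.
rewrite linear_sum /= big_mkcond /=; apply: eq_bigr => k _.
case: ltnP => [_|le_pk]; first by rewrite linearZ /= rmorphXn /= horner_algX mulr_algl.
by rewrite nth_default // scale0r.
Qed.

Lemma mcoeff_split_mpoly (K : fieldType) n (p : 'I_n -> {poly K}) (m : 'X_{1..n}) :
  (split_mpoly p)@_m = \prod_(i < n) (p i)`_(m i).
Proof.
(* One bound for all sizes, also above every [m i], so that [m] is itself one of the index functions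
   of the expanded product. *)
pose N := (\max_(i < n) maxn (size (p i)) (m i).+1)%N.
have leN i : (maxn (size (p i)) (m i).+1 <= N)%N by apply: leq_bigmax.
have le_size i : (size (p i) <= N)%N by apply: leq_trans (leN i); apply: leq_maxl.
have lt_m i : (m i < N)%N by apply: leq_trans (leN i); apply: leq_maxr.
rewrite /split_mpoly (eq_bigr _ (fun i _ => horner_algE _ (le_size i))).
rewrite bigA_distr_bigA /= raddf_sum /=.
rewrite (bigD1 [ffun i => Ordinal (lt_m i)]) //= [X in _ + X]big1 ?addr0 => [|h neq_h].
  rewrite scaler_prod mcoeffZ.
  rewrite [X in _ * X](_ : _ = 1) ?mulr1; first by apply: eq_bigr => i _; rewrite ffunE.
  under eq_bigr do rewrite ffunE /=.
  by rewrite -mpolyXE_id mcoeffX eqxx.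
rewrite scaler_prod mcoeffZ.
rewrite (eq_bigr (fun i => 'X_i ^+ [multinom (h j : nat) | j < n] i)); last first.
  by move=> i _; rewrite mnmE.
rewrite -mpolyXE_id mcoeffX; case: eqP => [em|]; last by rewrite mulr0.
case/eqP: neq_h; apply/ffunP => i; apply: val_inj; rewrite ffunE /=.
by rewrite -em mnmE.
Qed.

Lemma shift_split_mpoly (K : fieldType) n (c : 'I_n -> K) (p : 'I_n -> {poly K}) :
  shift_mpoly c (split_mpoly p) = split_mpoly (fun i => p i \Po ('X + (c i)%:P)).
Proof.
rewrite /shift_mpoly /split_mpoly rmorph_prod /=; apply: eq_bigr => i _.
rewrite (horner_algE _ (leqnn (size (p i)))) raddf_sum /=.
rewrite comp_polyE linear_sum /=; apply: eq_bigr => k _.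
rewrite linearZ /= rmorphXn /= comp_mpolyXU -tnth_nth tnth_mktuple.
rewrite linearZ /= mulr_algl rmorphXn rmorphD /= horner_algX horner_algC.
by rewrite alg_mpolyC addrC.
Qed.

(** Induction on the degree: ['X_[g]] is [p] minus a combination of monomials of [U] of lower
    degree. This serves both the Newton expansion and the reduction modulo polynomials vanishing on
    the grid. *)
Lemma triangular_span (K : fieldType) n (G : {mpoly K[n]} -> Prop)
    (U : pred 'X_{1..n}) :
  G 0 -> (forall a p q, G p -> G q -> G (a *: p + q)) ->
  (forall g, U g -> exists p, [/\ G p, p@_g = 1 & forall m, m \in msupp p ->
     m != g -> U m /\ (mdeg m < mdeg g)%N]) ->
  forall p, (forall m, m \in msupp p -> U m) -> G p.
Proof.
move=> G0 Glin tri.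
have Gsum p : (forall m, m \in msupp p -> G 'X_[m]) -> G p.
  move=> GX; rewrite [p]mpolyE big_seq; elim/big_ind: _ => // [q r Gq Gr|m /GX Gm].
    by rewrite -[q]scale1r; apply: Glin.
  by rewrite -[_ *: _]addr0; apply: Glin.
suff GX k g : (mdeg g < k)%N -> U g -> G 'X_[g].
  by move=> p pU; apply: Gsum => m /pU; apply: (GX (mdeg m).+1).
elim: k g => // k IH g lt_gk /tri [p [Gp pg1 plow]].
rewrite -[X in G X](addrNK p) addrC -[X in _ + X]opprB -scaleN1r addrC.
apply: Glin => //; apply: Gsum => m; rewrite mcoeff_msupp mcoeffB mcoeffX.
have [->|neq_mg] := eqVneq m g; first by rewrite pg1 subrr eqxx.
rewrite subr0 -mcoeff_msupp => /plow /(_ neq_mg) [Um lt_m]; apply: IH => //.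
exact: leq_trans lt_m _.
Qed.

Lemma gap_split_mpoly (K : fieldType) n (lam : 'I_n -> nat) (g : 'X_{1..n})
    (p : 'I_n -> {poly K}) :
  (forall i, gap_monic (lam i) (g i) (p i)) ->
  (split_mpoly p)@_g = 1 /\
  forall m, m \in msupp (split_mpoly p) ->
    forall i, m i = g i \/ (m i + lam i < g i)%N.
Proof.
move=> gp; split=> [|m]; rewrite ?mcoeff_msupp mcoeff_split_mpoly.
  by rewrite big1 // => i _; case: (gp i).
by move=> /prodf_neq0 nz i; case: (gp i) => _; apply; apply: nz.
Qed.

Lemma mdeg_ltn n (m g : 'X_{1..n}) :
  (forall i, m i <= g i)%N -> m != g -> (mdeg m < mdeg g)%N.
Proof.
move=> le_mg; apply: contraR; rewrite -leqNgt !mdegE => le_deg.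
apply/eqP/mnmP => i; apply/eqP; move: i.
have [_ e] := @leqif_sum 'I_n xpredT (fun i => m i == g i) (fun i => m i) (fun i => g i)
   (fun i _ => leqif_eq (le_mg i)).
move: e; rewrite eqn_leq le_deg leq_sum => [/esym/forallP //|i _]; exact: le_mg.
Qed.

(** * Order of vanishing, read off the coefficients *)

Definition vanishes_to (K : fieldType) n t (p : {mpoly K[n]}) : Prop :=
  forall m : 'X_{1..n}, (mdeg m < t)%N -> p@_m = 0.

Lemma vanishes_toM (K : fieldType) n a b (p q : {mpoly K[n]}) :
  vanishes_to a p -> vanishes_to b q -> vanishes_to (a + b) (p * q).
Proof.
move=> pa qb m lt_m; rewrite mcoeffM big1 // => -[k1 k2] /= /eqP em.
have [/pa ->|le_a] := ltnP (mdeg k1) a; first by rewrite mul0r.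
rewrite qb ?mulr0 // -(ltn_add2l a) (leq_ltn_trans _ lt_m) //.
by apply: (@leq_trans (mdeg k1 + mdeg k2)); rewrite ?leq_add2r // -mdegD -em.
Qed.

Lemma vanishes_to_ideal (K : fieldType) n t (G : {mpoly K[n]} -> Prop) :
  (forall p, G p -> vanishes_to t p) ->
  forall p, gen_ideal G p -> vanishes_to t p.
Proof.
move=> Gt p [s [sG ->]] m lt_m; rewrite raddf_sum big_seq /= big1 // => ag.
by move=> /sG/Gt agt; apply: (@vanishes_toM _ _ 0 t).
Qed.

(** Elements of [var_ideal] have no constant term, orders add up in products, and ideal combinations
    preserve a lower bound on the order. *)
Lemma fold_zero_vanishes (K : fieldType) n t (f : {mpoly K[n]}) (c : 'I_n -> K) :
  fold_zero t f c -> vanishes_to t (shift_mpoly c f).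
Proof.
apply: vanishes_to_ideal => p [h [hI ->]].
have h1 i : vanishes_to 1 (h i).
  apply: vanishes_to_ideal (hI i) => q [j ->] m.
  by rewrite ltnS leqn0 mdeg_eq0 => /eqP ->; rewrite mcoeffX mnm1_eq0.
elim: t h {hI} h1 => [|t IH] h h1; first by move=> m.
rewrite big_ord_recl; apply: (@vanishes_toM _ _ 1 t) => //.
by apply: IH => i; apply: h1.
Qed.

(** * Nonvanishing of polynomials of small quotient degree *)

(** For positive [d] this is the largest [mdeg b] among the [b] with [b i * d i <= m i] for all [i].
    The theorem's first condition on [alpha] thus says that its value there is less than [t]. *)
Definition quot_deg n (d : 'I_n -> nat) (m : 'X_{1..n}) : nat :=
  (\sum_(i < n) m i %/ d i)%N.

Lemma shift_mpolyP (K : fieldType) n (c : 'I_n -> K) (a : K) (p q : {mpoly K[n]}) :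
  shift_mpoly c (a *: p + q) = a *: shift_mpoly c p + shift_mpoly c q.
Proof. by rewrite /shift_mpoly linearP. Qed.

Lemma mcoeff_shift_sum (K : fieldType) n (c : 'I_n -> K) (I : finType)
    (a : I -> K) (p : I -> {mpoly K[n]}) (m : 'X_{1..n}) :
  (shift_mpoly c (\sum_i a i *: p i))@_m = \sum_i a i * (shift_mpoly c (p i))@_m.
Proof.
elim/big_rec2: _ => [|i x y _ <-]; first by rewrite /shift_mpoly raddf0 mcoeff0.
by rewrite shift_mpolyP mcoeffD mcoeffZ.
Qed.

Lemma newton_span (K : fieldType) n t (S : 'I_n -> {fset K}) (r : {mpoly K[n]}) :
  (forall i, 0 < #|` S i|)%N ->
  (forall m, m \in msupp r -> (quot_deg (fun i => #|` S i|) m < t)%N) ->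
  exists k (rho : 'X_{1..n < k} -> K),
    (forall m, rho m != 0 -> (quot_deg (fun i => #|` S i|) m < t)%N) /\
    r = \sum_m rho m *: split_mpoly (fun i => newton (S i) (bmnm m i)).
Proof.
move=> S_gt0 rt; pose k := msize r; exists k.
(* The degree bound keeps all expansions in the same finite index type throughout the induction. *)
pose U m := (quot_deg (fun i => #|` S i|) m < t)%N && (mdeg m < k)%N.
have rU m : m \in msupp r -> U m by move=> mr; rewrite /U rt // msize_mdeg_lt.
clearbody k; move: r {rt} rU; apply: triangular_span => [|a p q [rp [rpt ->]] [rq [rqt ->]]|g].
- exists (fun=> 0); split=> [m|]; first by rewrite eqxx.
  by rewrite big1 // => m _; rewrite scale0r.
- exists (fun m => a * rp m + rq m); split=> [m|].
    have [e|/rqt //] := eqVneq (rq m) 0.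
    rewrite e addr0 mulf_eq0 negb_or => /andP [_]; exact: rpt.
  rewrite scaler_sumr -big_split /=; apply: eq_bigr => m _.
  by rewrite scalerDl scalerA.
case/andP => gt gk.
have [p1 plow] := gap_split_mpoly (fun i => gap_monic_newton (g i) (S_gt0 i)).
exists (split_mpoly (fun i => newton (S i) (g i))); split=> //.
  exists (fun m => (bmnm m == g)%:R); split=> [m|].
    by have [->|_] := eqVneq (bmnm m) g; rewrite ?eqxx.
  rewrite (bigD1 (BMultinom gk)) //= eqxx scale1r big1 ?addr0 // => m.
  by rewrite -val_eqE /= => /negbTE ->; rewrite scale0r.
move=> m /plow low neq_mg.
have le_mg i : (m i <= g i)%N.
  by case: (low i) => [->//|]; rewrite addn0; apply: ltnW.
have lt_mg := mdeg_ltn le_mg neq_mg.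
split=> //; rewrite /U (ltn_trans lt_mg gk) andbT; apply: leq_ltn_trans gt.
by apply: leq_sum => i _; apply: leq_div2r.
Qed.

(* For a minimal multi-index [m] in the Newton expansion of [r], the
   coefficient of order [m %/ d] at the node with indices [m %% d] only sees
   the term [m]: any other term [m'] has some [m' i > m i] and thus vanishes to
   higher order in the [i]-th variable. *)
Lemma small_quot_deg_nonvanishing (K : fieldType) n t (S : 'I_n -> {fset K})
    (r : {mpoly K[n]}) :
  (forall i, 0 < #|` S i|)%N -> r != 0 ->
  (forall m, m \in msupp r -> (quot_deg (fun i => #|` S i|) m < t)%N) ->
  exists s : 'I_n -> K,
    (forall i, s i \in S i) /\ ~ vanishes_to t (shift_mpoly s r).
Proof.
move=> S_gt0 nz_r /(newton_span S_gt0) [k [rho [rhot er]]].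
have [m0 nz_m0] : exists m, rho m != 0.
  apply/existsP; apply: contraR nz_r => /existsPn z.
  rewrite er big1 // => m _; move: (z m); rewrite negbK => /eqP ->.
  by rewrite scale0r.
case: (@arg_minnP _ m0 (fun m => rho m != 0) (fun m => mdeg m) nz_m0) => m nz_m minm.
exists (fun i => (S i : seq K)`_(m i %% #|` S i|)); split=> [i|van].
  by rewrite -[_ \in S i]/(_ \in enum_fset (S i)) mem_nth // ltn_mod.
have := van [multinom (m i %/ #|` S i|)%N | i < n].
rewrite mdegE (eq_bigr (fun i => m i %/ #|` S i|)%N); last first.
  by move=> i _; rewrite mnmE.
move=> /(_ (rhot m nz_m)).
rewrite er mcoeff_shift_sum (bigD1 m) //= big1 ?addr0.
  rewrite shift_split_mpoly mcoeff_split_mpoly.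
  apply/eqP; rewrite mulf_neq0 //; apply/prodf_neq0 => i _; rewrite mnmE.
  by apply: newton_shift_neq0 => //; apply: fset_uniq.
move=> m' neq_m; rewrite shift_split_mpoly.
have [->|nz_m'] := eqVneq (rho m') 0; first by rewrite mul0r.
(* Otherwise [m'] lies below [m] in every coordinate and has smaller degree, against the choice of
   [m]. *)
have [i lt_i] : exists i, (m i < m' i)%N.
  apply/existsP; apply: contraR neq_m => /existsPn le_m.
  apply/eqP/val_inj/eqP => /=; apply: contraT => /mdeg_ltn lt_m.
  have := minm m' nz_m'; rewrite leqNgt lt_m // => i.
  by rewrite leqNgt le_m.
rewrite mcoeff_split_mpoly (bigD1 i) //= mnmE newton_shift_eq0 //.
by rewrite mul0r mulr0.
Qed.

(** * Reduction modulo polynomials vanishing to order [t] on the grid *)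

(** Climb from [a] one unit at a time: below the degree of [c], some coordinate can still grow. *)
Lemma mnm_between n t (a c : 'X_{1..n}) :
  (forall i, a i <= c i)%N -> (mdeg a <= t <= mdeg c)%N ->
  exists b : 'X_{1..n}, [/\ mdeg b = t, forall i, (a i <= b i)%N
    & forall i, (b i <= c i)%N].
Proof.
elim: t => [|t IH] le_ac /andP [le_at le_tc].
  exists a; split=> //; apply/eqP; by rewrite -leqn0.
have [e|lt_at] := eqVneq (mdeg a) t.+1; first by exists a.
have [|b [db ab bc]] := IH le_ac.
  by rewrite -ltnS ltn_neqAle lt_at le_at ltnW.
have [i lt_i] : exists i, (b i < c i)%N.
  apply/existsP; apply: contraTT le_tc => /existsPn le_cb.
  rewrite -ltnNge ltnS -db !mdegE; apply: leq_sum => i _.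
  by rewrite leqNgt le_cb.
exists (b + U_(i))%MM; split=> [|j|j]; first by rewrite mdegD mdeg1 db addn1.
  by rewrite mnmDE (leq_trans (ab j)) ?leq_addr.
rewrite mnmDE mnm1E; case: eqP => [<-|_]; last by rewrite addn0.
by rewrite addn1.
Qed.

Definition node_poly_pow (K : fieldType) n (S : 'I_n -> {fset K})
    (g b : 'X_{1..n}) : {mpoly K[n]} :=
  split_mpoly (fun i => (\prod_(a <- S i) ('X - a%:P)) ^+ b i *
                        'X^(g i - #|` S i| * b i)).

(** A monomial of degree below [mdeg b] has some [m i < b i], while the [i]-th factor is divisible
    by the [b i]-th power of ['X - (s i)%:P]. *)
Lemma node_poly_pow_vanishes (K : fieldType) n (S : 'I_n -> {fset K})
    (g b : 'X_{1..n}) (s : 'I_n -> K) :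
  (forall i, s i \in S i) -> vanishes_to (mdeg b) (shift_mpoly s (node_poly_pow S g b)).
Proof.
move=> sS m lt_m; rewrite shift_split_mpoly mcoeff_split_mpoly.
have [i lt_i] : exists i, (m i < b i)%N.
  apply/existsP; apply: contraTT lt_m => /existsPn le_bm.
  by rewrite -leqNgt !mdegE; apply: leq_sum => i _; rewrite leqNgt le_bm.
rewrite (bigD1 i) //= (big_rem (s i)) ?sS //=.
by rewrite exprMn -mulrA coef_shift_root_exp lt_i mul0r.
Qed.

Lemma gap_node_poly_pow (K : fieldType) n (lam : 'I_n -> nat) (S : 'I_n -> {fset K})
    (g b : 'X_{1..n}) :
  (forall i, null_set (lam i) (S i)) -> (forall i, #|` S i| * b i <= g i)%N ->
  (node_poly_pow S g b)@_g = 1 /\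
  forall m, m \in msupp (node_poly_pow S g b) ->
    forall i, m i = g i \/ (m i + lam i < g i)%N /\ (#|` S i| <= g i)%N.
Proof.
move=> S_null le_bg.
have gp i : gap_monic (if (#|` S i| <= g i)%N then lam i else g i) (g i)
    ((\prod_(a <- S i) ('X - a%:P)) ^+ b i * 'X^(g i - #|` S i| * b i)).
  rewrite -{3}(subnKC (le_bg i)); apply: gap_monicM; last exact: gap_monicXn.
  case: leqP => [_|lt_g]; first exact/gap_monic_exp/null_set_gap.
  case: (b i) (le_bg i) => [_|e]; first by rewrite muln0 expr0; apply: gap_monic1.
  by rewrite mulnS => /(leq_trans (leq_addr _ _)); rewrite leqNgt lt_g.
have [-> low] := gap_split_mpoly gp; split=> // m /low lowm i.
case: (lowm i) => [->|]; first by left.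
by case: (leqP #|` S i| (g i)) => [le lt|_]; [right | rewrite ltnNge leq_addl].
Qed.

(* Modulo polynomials vanishing to order [t] on [S], a monomial [g] reduces to
   monomials [m] with [quot_deg m < t], each [m i] being [g i] or below the gap
   [g i - lam i]; when [g i < #|` S i|] the exponent [g i] is never touched. *)
Definition reducible_to n (lam d : 'I_n -> nat) (g m : 'X_{1..n}) : bool :=
  [forall i, (m i == g i) || (m i + lam i < g i)%N && (d i <= g i)%N].

Lemma reducible_to_trans n (lam d : 'I_n -> nat) (g m a : 'X_{1..n}) :
  reducible_to lam d g m -> reducible_to lam d m a -> reducible_to lam d g a.
Proof.
move=> /forallP gm /forallP ma; apply/forallP => i.
case/orP: (ma i) (gm i) => [/eqP -> //|/andP [lt_a le_d]].
case/orP => [/eqP <-|/andP [lt_m ->]]; first by rewrite lt_a le_d orbT.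
rewrite andbT (leq_trans lt_a) ?orbT //.
by apply: leq_trans (ltnW lt_m); rewrite leq_addr.
Qed.

(** Monomials of small [quot_deg] are kept. Any other one is not reducible to [alpha], so its
    rewriting rule avoids [alpha]; by transitivity, so do all later rewritings. *)
Lemma exists_reduction (K : fieldType) n t (lam : 'I_n -> nat) (S : 'I_n -> {fset K})
    (f : {mpoly K[n]}) (alpha : 'X_{1..n}) :
  (forall i, 0 < #|` S i|)%N -> (forall i, null_set (lam i) (S i)) ->
  (forall g, g \in msupp f -> (quot_deg (fun i => #|` S i|) g < t)%N \/
     ~~ reducible_to lam (fun i => #|` S i|) g alpha) ->
  exists r : {mpoly K[n]},
    [/\ r@_alpha = f@_alpha,
        forall m, m \in msupp r -> (quot_deg (fun i => #|` S i|) m < t)%N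
      & forall s, (forall i, s i \in S i) -> vanishes_to t (shift_mpoly s (f - r))].
Proof.
move=> S_gt0 S_null; set qd := quot_deg _; set red := reducible_to _ _ => fU.
pose U g := (qd g < t)%N || ~~ red g alpha.
have {}fU g : g \in msupp f -> U g by case/fU => h; rewrite /U h ?orbT.
move: f fU; apply: triangular_span => [|a p q [rp [rpa rpt pv]] [rq [rqa rqt qv]]|g].
- exists 0; split=> [|m|s _ m _]; rewrite ?msupp0 //.
  by rewrite subr0 /shift_mpoly raddf0 mcoeff0.
- exists (a *: rp + rq); split=> [|m|s sS m lt_m].
  + by rewrite !mcoeffD !mcoeffZ rpa rqa.
  + rewrite mcoeff_msupp mcoeffD mcoeffZ.
    have [e|] := eqVneq (rq@_m) 0; last by rewrite -mcoeff_msupp => /rqt.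
    by rewrite e addr0 mulf_eq0 negb_or -mcoeff_msupp => /andP [_ /rpt].
  rewrite opprD addrACA -scalerBr shift_mpolyP mcoeffD mcoeffZ.
  by rewrite pv // qv // mulr0 addr0.
have [lt_t _|le_t] := ltnP (qd g) t.
  exists 'X_[g]; split; last first.
  - by move=> m; rewrite msuppX inE => /eqP ->; rewrite eqxx.
  - by rewrite mcoeffX eqxx.
  exists 'X_[g]; split=> [//|m|s _ m _].
    by rewrite msuppX inE => /eqP ->.
  by rewrite subrr /shift_mpoly raddf0 mcoeff0.
rewrite /U ltnNge le_t /= => nred.
pose c := [multinom (g i %/ #|` S i|)%N | i < n].
have dc : mdeg c = qd g by rewrite mdegE; apply: eq_bigr => i _; rewrite mnmE.
have [i||b [db _ bc]] := @mnm_between n t 0%MM c; rewrite ?mdeg0 ?dc ?mnm0E //.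
have le_bg i : (#|` S i| * b i <= g i)%N.
  by rewrite mulnC -leq_divRL //; have := bc i; rewrite mnmE.
have [p1 plow] := gap_node_poly_pow S_null le_bg.
have pred m : m \in msupp (node_poly_pow S g b) -> red g m.
  move=> /plow low; apply/forallP => i.
  by case: (low i) => [->|[-> ->]]; rewrite ?eqxx ?orbT.
exists (node_poly_pow S g b); split=> // [|m mp neq_mg].
  (* The rule itself reduces to 0: it vanishes to order [mdeg b = t] on the grid and does not
     contain [alpha]. *)
  exists 0; split=> [|m|s sS m]; rewrite ?msupp0 //.
    by rewrite mcoeff0; apply/esym/eqP; rewrite mcoeff_eq0; apply: contra nred => /pred.
  by rewrite subr0 -db; apply: node_poly_pow_vanishes.
split; last first.
  apply: mdeg_ltn neq_mg => i; case: (plow m mp i) => [->//|[lt_m _]].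
  by rewrite ltnW // (leq_ltn_trans _ lt_m) ?leq_addr.
by apply/orP; right; apply: contra nred; apply: reducible_to_trans (pred m mp).
Qed.

Theorem theorem2p2 (K : fieldType) (n t : nat) (n_gt0 : (0 < n)%N)
    (t_gt0 : (0 < t)%N) (lam : 'I_n -> nat) (S : 'I_n -> {fset K})
    (S_null : forall i : 'I_n, null_set (lam i) (S i))
    (f : {mpoly K[n]}) (alpha : 'X_{1..n})
    (alpha_small : forall beta : 'X_{1..n}, mdeg beta = t ->
       exists i : 'I_n, (alpha i < beta i * #|` S i|)%N)
    (alpha_in_f : alpha \in msupp f)
    (others : forall gamma : 'X_{1..n}, gamma \in msupp f -> gamma <> alpha ->
       exists i : 'I_n,
         gamma i <> alpha i /\
         (((gamma i < alpha i)%N \/ (alpha i < gamma i <= alpha i + lam i)%N) \/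
          (forall beta : 'X_{1..n}, mdeg beta = t -> (0 < beta i)%N ->
             exists j : 'I_n, (gamma j < beta j * #|` S j|)%N))) :
  exists s : 'I_n -> K, (forall i : 'I_n, s i \in S i) /\ ~ fold_zero t f s.
Proof.
have S_gt0 i : (0 < #|` S i|)%N.
  (* Test the condition on [t] times the [i]-th unit vector: an empty [S i] would give
     [alpha i < 0]. *)
  have [|j] := alpha_small (U_(i) *+ t)%MM; first by rewrite mdegMn mdeg1 mul1n.
  rewrite mulmnE mnm1E; case: eqP => [<-|_]; last by rewrite !mul0n.
  by case: #|` S i| => //; rewrite muln0.
pose d i := #|` S i|.
(* The lower bound [a] is 0 when [g] is [alpha], and [U_(i)] when [b i > 0] is required. *)
have large (g a : 'X_{1..n}) : (forall i, a i <= g i %/ d i)%N -> (mdeg a <= t)%N ->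
    (t <= quot_deg d g)%N -> exists b : 'X_{1..n},
    [/\ mdeg b = t, forall i, (a i <= b i)%N & forall i, (b i * d i <= g i)%N].
  move=> ag at_ tg; pose c := [multinom (g i %/ d i)%N | i < n].
  have [i||b [db ab bc]] := @mnm_between n t a c; first by rewrite mnmE ag.
    by rewrite at_ mdegE (eq_bigr (fun i => g i %/ d i)%N) // => i _; rewrite mnmE.
  by exists b; split=> // i; rewrite -leq_divRL ?(S_gt0 i) //; have := bc i; rewrite mnmE.
have fU g : g \in msupp f ->
    (quot_deg d g < t)%N \/ ~~ reducible_to lam d g alpha.
  move=> gf; have [|le_t] := ltnP (quot_deg d g) t; [by left | right].
  have [eg|neq_g] := eqVneq g alpha.
    have [|||b [db _ bd]] := large g 0%MM; rewrite ?mdeg0 //.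
      by move=> i; rewrite mnm0E.
    by have [i] := alpha_small b db; rewrite -eg ltnNge bd.
  apply/negP => /forallP red.
  have [i [neq_i]] := others g gf (elimN eqP neq_g).
  (* Since [g i] differs from [alpha i], reducibility forces [alpha i + lam i < g i], which excludes
     both ranges around [alpha i]. *)
  have := red i; rewrite eq_sym (negbTE (introN eqP neq_i)) /= => /andP [gap le_d].
  have lt_a : (alpha i < g i)%N by rewrite (leq_ltn_trans _ gap) ?leq_addr.
  case=> [[|/andP [_]]|]; first by rewrite ltnNge ltnW.
    by rewrite leqNgt gap.
  (* Reducibility also gives [d i <= g i], so [U_(i)] is an admissible lower bound and the resulting
     [b] violates the last alternative. *)
  have [j|||b [db ab bd]] := large g U_(i)%MM; rewrite ?mdeg1 //.
    rewrite mnm1E; case: eqP => [<-|//]; rewrite divn_gt0 //; exact: S_gt0.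
  move=> /(_ b db); have := ab i; rewrite mnm1E eqxx => -> /(_ isT) [j].
  by rewrite ltnNge bd.
have [r [ra rt rv]] := exists_reduction S_gt0 S_null fU.
have nz_r : r != 0.
  by apply: contraTneq alpha_in_f => r0; rewrite -mcoeff_eq0 -ra r0 mcoeff0.
have [s [sS nv]] := small_quot_deg_nonvanishing S_gt0 nz_r rt.
exists s; split=> // /fold_zero_vanishes fv; apply: nv => m lt_m.
have := rv s sS m lt_m; rewrite -[f - r]addrC -scaleN1r shift_mpolyP mcoeffD mcoeffZ.
by rewrite fv // addr0 mulN1r => /eqP; rewrite oppr_eq0 => /eqP.
Qed.
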